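(* Let $q$ be a power of a prime. For any multiplicative characters $A,A',B,B',C$ of $\mathbb{F}_q^*$, any $x,t\in\mathbb{F}_q^*\setminus\{1\}$ and any $y\in\mathbb{F}_q$, \begin{align*} &\frac{1}{q-1}\sum_{\theta}\binom{A\theta}{\theta}F_{3}(A\theta,A';B,B';C;x,y)\,\theta(t)\\ &=\overline{A}(1-t)\,F_{3}\left(A,A';B,B';C;\frac{x}{1-t},y\right)\\ &\quad-\overline{A}(-t)\,B(-1)\,\overline{C}(x)\,\overline{B}C(1-x)\,{}_{2}F_1\left(\begin{matrix}A',B'\\ \overline{B}C\end{matrix}\bigg|-\frac{y(1-x)}{x}\right), \end{align*} where the sum is over all multiplicative characters $\theta$ of $\mathbb{F}_q^*$.
   Context: $\mathbb{F}_q$ is the finite field with $q$ elements. Characters are complex-valued multiplicative characters of $\mathbb{F}_q^*$; every character $\chi$, including the trivial character $\varepsilon$, is extended to $\mathbb{F}_q$ by $\chi(0)=0$. $\overline{\chi}$ is the inverse of $\chi$; juxtaposition of characters is their product, so that e.g. $\overline{B}C(1-x)$ means $(\overline{B}C)(1-x)$. For characters $\chi,\lambda$ the Jacobi sum is $J(\chi,\lambda)=\sum_{u\in\mathbb{F}_q}\chi(u)\lambda(1-u)$, and the binomial coefficient of characters $A,B$ is $\binom{A}{B}=B(-1)J(A,\overline{B})$ (no factor $1/q$). For characters $A,B,C$ and $x\in\mathbb{F}_q$, ${}_2F_1\left(\begin{matrix}A,B\\ C\end{matrix}\bigg|x\right)=\varepsilon(x)\,BC(-1)\sum_{y\in\mathbb{F}_q}B(y)\,\overline{B}C(1-y)\,\overline{A}(1-xy)$.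 The finite field Appell series $F_3$ is $$F_{3}(A,A';B,B';C;x,y)=\varepsilon(xy)\,BB'(-1)\sum_{u,v\in\mathbb{F}_q}B(u)\,B'(v)\,C\overline{B}\,\overline{B'}(1-u-v)\,\overline{A}(1-ux)\,\overline{A'}(1-vy).$$ *)

(* Defs.v *)
From HB Require Import structures.
From mathcomp Require Import all_boot all_order all_fingroup all_algebra.
From mathcomp Require Import all_solvable all_field all_character.

Set Implicit Arguments.
Unset Strict Implicit.
Unset Printing Implicit Defensive.

Import Order.TTheory GRing.Theory Num.Theory.
Local Open Scope ring_scope.

(* The multiplicative characters of F are the linear characters of its unit
   group, i.e. the phi : cfunits F such that phi \is a linear_char. Their values
   are roots of unity, so algC-valued characters are all the complex ones. The
   trivial character is 1; * is pointwise, and so is ^-1 on characters. *)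
Notation cfunits F := 'CF([set: {unit F}]%G).

Section Characters.

Variable F : finFieldType.
Implicit Types (chi lam A B C : cfunits F) (x y : F).

(* Extension to F by chi(0) = 0, also for the trivial character. *)
Definition mext chi x : algC := if insub x is Some u then chi u else 0.

Lemma mext_unit chi (u : {unit F}) : mext chi (val u) = chi u.
Proof. by rewrite /mext valK. Qed.

Lemma mext0 chi : mext chi 0 = 0.
Proof. by rewrite /mext insubF // unitr0. Qed.

Definition mchars : seq (cfunits F) :=
  [seq theta <- irr [set: {unit F}]%G | theta \is a linear_char].

Lemma mem_mchars chi : (chi \in mchars) = (chi \is a linear_char).
Proof. by rewrite mem_filter andb_idr // => /lin_char_irr. Qed.

Lemma uniq_mchars : uniq mchars.
Proof. exact: filter_uniq (free_uniq (irr_free _)). Qed.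

Definition jacobi chi lam : algC := \sum_(u : F) mext chi u * mext lam (1 - u).

(* No factor 1 / q here, contrary to Greene's normalization. *)
Definition mbinom A B : algC := mext B (-1) * jacobi A B^-1.

Definition hyp2F1 A B C x : algC :=
  mext 1 x * mext (B * C) (-1) *
  \sum_(y : F) mext B y * mext (B^-1 * C) (1 - y) * mext A^-1 (1 - x * y).

Definition appellF3 A A' B B' C x y : algC :=
  mext 1 (x * y) * mext (B * B') (-1) *
  \sum_(u : F) \sum_(v : F)
    mext B u * mext B' v * mext (C * B^-1 * B'^-1) (1 - u - v) *
    mext A^-1 (1 - u * x) * mext A'^-1 (1 - v * y).

End Characters.

(* Main.v *)
Require Import Defs.
From HB Require Import structures.
From mathcomp Require Import all_boot all_order all_fingroup all_algebra.
From mathcomp Require Import all_solvable all_field all_character.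
From mathcomp Require Import ring.

Set Implicit Arguments.
Unset Strict Implicit.
Unset Printing Implicit Defensive.

Import Order.TTheory GRing.Theory Num.Theory.
Local Open Scope ring_scope.

(** The sum over theta is a generating function, and a finite field version of
    the binomial theorem evaluates it inside F3.  Writing w = 1 - u x, the only
    factors that involve theta are a binomial coefficient of characters,
    theta^-1(w) and theta(t), and [finite_binomial_theorem] says that

      1/(q-1) sum_theta binom(A theta, theta) (A theta)^-1(w) theta(t)
        = A^-1(w - t) - [w = 0] A^-1(- t).

    This is the analogue of (1 - t/w)^-a w^-a = (w - t)^-a.  The second term
    is there because characters vanish at 0, so that for w = 0 the left side is
    0 while A^-1(w - t) is A^-1(- t).  The formula itself is orthogonality of
    characters: opening the Jacobi sum as a sum over s leaves a sum over theta
    of theta(- s t / ((1 - s) w)), which selects s = w / (w - t).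

    Since 1 - u x - t = (1 - t) (1 - u x / (1 - t)), the main terms
    A^-1(w - t) rebuild F3 at x / (1 - t), with the factor A^-1(1 - t).  The
    correction survives only for u = 1/x.  There the double sum F3
    degenerates to a single sum over v, and the dilation v -> (1 - 1/x) v turns
    1 - u - v into (1 - 1/x) (1 - v) and shows this sum to be the 2F1 of the
    statement ([appell_slice_inv]). *)

(** * Characters extended by zero *)

Section Extension.

Variable F : finFieldType.
Implicit Types (A B chi : cfunits F) (x y z w t : F).

Variant unit_or_zero_spec : F -> Type :=
  | IsZero : unit_or_zero_spec 0
  | IsUnit (u : {unit F}) : unit_or_zero_spec (val u).

Lemma unit_or_zeroP x : unit_or_zero_spec x.
Proof.
have [->|] := eqVneq x 0; first exact: IsZero.
by rewrite -unitfE => xU; apply: (IsUnit (Sub x xU)).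
Qed.

Lemma mextMl A B x : mext (A * B) x = mext A x * mext B x.
Proof.
case: (unit_or_zeroP x) => [|u]; first by rewrite !mext0 mul0r.
by rewrite !mext_unit cfunE.
Qed.

Lemma mextM A x y : A \is a linear_char ->
  mext A (x * y) = mext A x * mext A y.
Proof.
move=> linA; case: (unit_or_zeroP x) => [|u]; first by rewrite mul0r mext0 mul0r.
case: (unit_or_zeroP y) => [|v]; first by rewrite mulr0 mext0 mulr0.
by rewrite -FinRing.val_unitM !mext_unit lin_charM ?inE.
Qed.

Lemma mextV A x : A \is a linear_char -> mext A^-1 x = mext A x^-1.
Proof.
move=> linA; case: (unit_or_zeroP x) => [|u]; first by rewrite invr0 !mext0.
by rewrite -FinRing.val_unitV !mext_unit invr_lin_char // cfunE lin_charV_conj ?inE.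
Qed.

Lemma mext_triv x : mext 1 x = (x != 0)%:R.
Proof.
case: (unit_or_zeroP x) => [|u]; first by rewrite mext0 eqxx.
by rewrite mext_unit cfun1E inE -unitfE (valP u).
Qed.

Lemma mext1 A : A \is a linear_char -> mext A 1 = 1.
Proof. by move=> linA; rewrite -[1]/(val (1%g : {unit F})) mext_unit lin_char1. Qed.

(** * Orthogonality and the finite binomial theorem *)

(** The second orthogonality relation against the identity element: the
    linear characters of an abelian group are all its irreducible ones, and each
    takes the value 1 there. *)
Lemma sum_lin_irr_abelian (gT : finGroupType) (G : {group gT}) (x : gT) :
    abelian G -> x \in G ->
  \sum_(phi <- irr G | phi \is a linear_char) phi x = #|G|%:R *+ (x == 1%g).
Proof.
move=> abG Gx; have lin_chi := char_abelianP _ abG.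
rewrite big_tuple; under eq_bigl do rewrite lin_chi.
have chi1 i : 'chi[G]_i x = 'chi_i x * ('chi_i 1%g)^*.
  by rewrite (lin_char1 (lin_chi i)) conjC1 mulr1.
rewrite (eq_bigr _ (fun i _ => chi1 i)) second_orthogonality_relation // class1G inE.
by rewrite (setIidPl _) // sub_cent1 (subsetP abG).
Qed.

Lemma sum_mchars_mext z :
  \sum_(chi <- mchars F) mext chi z = (#|F|%:R - 1) * (z == 1)%:R.
Proof.
have abG : abelian [set: {unit F}] by exact: cyclic_abelian (field_unit_group_cyclic _).
case: (unit_or_zeroP z) => [|u].
  rewrite big1 => [|chi _]; last exact: mext0.
  by rewrite eq_sym oner_eq0 mulr0.
under eq_bigr do rewrite mext_unit.
rewrite big_filter sum_lin_irr_abelian ?inE // card_finField_unit.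
rewrite -(inj_eq val_inj) FinRing.val_unit1 -mulr_natr -subn1.
by rewrite natrB // ltnW // finNzRing_gt1.
Qed.

(** The case s = 1 relies on division by zero: the quotient is then 0, which
    agrees with the right side because t != 0. *)
Lemma binomial_kernel_eq1 s w t : w != 0 -> t != 0 ->
  (- (s * t) / ((1 - s) * w) == 1) = (s * (w - t) == w).
Proof.
move=> w0 t0; have [->|s1] := eqVneq s 1.
  rewrite subrr !mul0r invr0 mulr0 eq_sym oner_eq0 mul1r.
  by rewrite -subr_eq0 addrAC subrr sub0r oppr_eq0 (negPf t0).
have d0 : (1 - s) * w != 0 by rewrite mulf_neq0 // subr_eq0 eq_sym.
rewrite -(inj_eq (mulIf d0)) divfK // mul1r eq_sym.
by rewrite -subr_eq0 -[RHS]subr_eq0 -[RHS]oppr_eq0; congr (_ == 0); ring.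
Qed.

(** For w != 0 this is Fourier inversion on the unit group: the numbers
    binom(A theta, theta) (A theta)^-1(w) are the Fourier coefficients of
    t |-> A^-1(w - t).  For w = 0 every coefficient vanishes, since
    characters are extended by 0, and the correction cancels A^-1(- t). *)
Lemma finite_binomial_theorem A w t : A \is a linear_char -> t != 0 ->
  (#|F|%:R - 1)^-1 *
    \sum_(theta <- mchars F)
      mbinom (A * theta) theta * mext (A * theta)^-1 w * mext theta t
  = mext A^-1 (w - t) - (w == 0)%:R * mext A^-1 (- t).
Proof.
move=> linA t0.
have q1 : #|F|%:R - 1 != 0 :> algC.
  by rewrite subr_eq0 pnatr_eq1 neq_ltn finNzRing_gt1 orbT.
have [->|w0] := eqVneq w 0.
  rewrite sub0r mul1r subrr big1 ?mulr0 // => theta _.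
  by rewrite mext0 mulr0 mul0r.
rewrite mul0r subr0.
have -> : \sum_(theta <- mchars F)
      mbinom (A * theta) theta * mext (A * theta)^-1 w * mext theta t =
    \sum_(s : F) mext A (s / w) *
      ((#|F|%:R - 1) * (s * (w - t) == w)%:R).
  under [RHS]eq_bigr do
    rewrite -binomial_kernel_eq1 // -sum_mchars_mext mulr_sumr.
  rewrite exchange_big /= !big_seq; apply: eq_bigr => theta.
  rewrite mem_mchars => linth.
  rewrite /mbinom /jacobi -!mulrA mulr_suml mulr_sumr; apply: eq_bigr => s _.
  rewrite !mextV ?rpredM // !mextMl invfM -[- (s * t)]mulN1r !mextM //.
  by ring.
rewrite mulr_sumr; have [wt|wt] := eqVneq (w - t) 0.
  (* No s solves s (w - t) = w here, and A^-1(w - t) is 0. *)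
  rewrite wt mext0 big1 // => s _.
  by rewrite mulr0 eq_sym (negPf w0) !mulr0.
rewrite (bigD1 (w / (w - t))) //= big1 => [|s].
  rewrite divfK // eqxx addr0 mulr1 mulrCA mulVf // mulr1 mextV //.
  by rewrite mulrAC divff ?mul1r.
by rewrite -(inj_eq (mulIf wt)) divfK // => /negPf->; rewrite !mulr0.
Qed.

(** * Slices of the Appell series *)

(** Neither A nor x enters a slice.  This is what lets the sum over theta act on
    the remaining factor of each u separately, and what allows F3 at x and at
    x / (1 - t) to be compared slice by slice. *)
Definition appell_slice A' B B' C u y : algC :=
  mext B u * \sum_(v : F)
    mext B' v * mext (C * B^-1 * B'^-1) (1 - u - v) * mext A'^-1 (1 - v * y).

Lemma appellF3_slice A A' B B' C x y :
  appellF3 A A' B B' C x y =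
  mext 1 (x * y) * mext (B * B') (-1) *
  \sum_(u : F) appell_slice A' B B' C u y * mext A^-1 (1 - u * x).
Proof.
congr (_ * _); apply: eq_bigr => u _.
rewrite /appell_slice mulr_sumr mulr_suml; apply: eq_bigr => v _.
by ring.
Qed.

(** At u = 1/x one has 1 - u = - (1 - x) / x =: k, so substituting k v for v
    makes the three-term argument 1 - u - v equal to k (1 - v), which is the
    shape of a 2F1; here k != 0 because x != 1.  The character values at k pulled out of the sum
    combine with B(1/x) into the prefactor. *)
Lemma appell_slice_inv A' B B' C x y :
  B \is a linear_char -> B' \is a linear_char -> C \is a linear_char ->
  x != 0 -> x != 1 ->
  mext 1 (x * y) * mext (B * B') (-1) * appell_slice A' B B' C x^-1 y =
  mext B (-1) * mext C^-1 x * mext (B^-1 * C) (1 - x) *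
  hyp2F1 A' B' (B^-1 * C) (- (y * (1 - x) / x)).
Proof.
move=> linB linB' linC x0 x1.
have x10 : 1 - x != 0 by rewrite subr_eq0 eq_sym.
pose k : F := - (1 - x) / x.
have k0 : k != 0 by rewrite mulf_neq0 ?oppr_eq0 ?invr_eq0.
have -> : - (y * (1 - x) / x) = k * y by rewrite /k; field.
rewrite /hyp2F1 /appell_slice.
have -> : mext 1 (k * y) = mext 1 (x * y).
  by rewrite !mext_triv (mulf_eq0 k) (mulf_eq0 x) (negPf x0) (negPf k0).
rewrite (reindex_inj (mulfI k0)) /=.
have -> : \sum_v mext B' (k * v) * mext (C * B^-1 * B'^-1) (1 - x^-1 - k * v) *
                 mext A'^-1 (1 - k * v * y) =
          mext (C * B^-1) k * \sum_v mext B' v * mext (B'^-1 * (B^-1 * C)) (1 - v) *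
                 mext A'^-1 (1 - k * y * v).
  rewrite mulr_sumr; apply: eq_bigr => v _.
  have -> : 1 - x^-1 - k * v = k * (1 - v) by rewrite /k; field.
  have -> : 1 - k * v * y = 1 - k * y * v by ring.
  have B'k : mext B' k * mext B' k^-1 = 1 by rewrite -mextM // divff ?mext1.
  rewrite mextM // [mext (C * B^-1 * B'^-1) _]mextM ?rpredM ?rpredV //.
  rewrite !mextMl ![mext _^-1 k]mextV //.
  rewrite -[RHS]mul1r -[X in _ = X * _]B'k; ring.
have Bx : mext B x * mext B x^-1 = 1 by rewrite -mextM // divff ?mext1.
rewrite !mextMl ![mext _^-1 _]mextV // invrN1.
have -> : k^-1 = -1 * (1 - x)^-1 * x.
  by rewrite /k; field; rewrite x0 x10 oppr_eq0.
have -> : mext C k = mext C (-1) * mext C (1 - x) * mext C x^-1.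
  by rewrite -!mextM // mulN1r.
rewrite !(mextM _ _ linB); set S := \sum_v _.
rewrite -[RHS]mul1r -[X in _ = X * _]Bx; ring.
Qed.

End Extension.

Theorem theorem4p1 (F : finFieldType) (A A' B B' C : cfunits F)
    (hA : A \is a linear_char) (hA' : A' \is a linear_char)
    (hB : B \is a linear_char) (hB' : B' \is a linear_char)
    (hC : C \is a linear_char)
    (x t y : F) (hx0 : x != 0) (hx1 : x != 1) (ht0 : t != 0) (ht1 : t != 1) :
  (#|F|%:R - 1)^-1 *
    (\sum_(theta <- mchars F)
       mbinom (A * theta) theta * appellF3 (A * theta) A' B B' C x y *
       mext theta t)
  = mext A^-1 (1 - t) * appellF3 A A' B B' C (x / (1 - t)) y
    - mext A^-1 (- t) * mext B (-1) * mext C^-1 x * mext (B^-1 * C) (1 - x) *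
      hyp2F1 A' B' (B^-1 * C) (- (y * (1 - x) / x)).
Proof.
set c := mext 1 (x * y) * mext (B * B') (-1).
have t10 : 1 - t != 0 by rewrite subr_eq0 eq_sym.
have -> : \sum_(theta <- mchars F)
    mbinom (A * theta) theta * appellF3 (A * theta) A' B B' C x y *
      mext theta t =
    \sum_(u : F) c * appell_slice A' B B' C u y *
      \sum_(theta <- mchars F)
        mbinom (A * theta) theta * mext (A * theta)^-1 (1 - u * x) *
        mext theta t.
  under [RHS]eq_bigr do rewrite mulr_sumr.
  rewrite exchange_big /=; apply: eq_bigr => theta _.
  rewrite appellF3_slice -/c !(mulr_sumr, mulr_suml).
  by apply: eq_bigr => u _; ring.
rewrite mulr_sumr.
under eq_bigr do rewrite mulrCA finite_binomial_theorem // mulrBr.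
rewrite sumrB; congr (_ - _).
  rewrite appellF3_slice.
  have -> : mext 1 (x / (1 - t) * y) = mext 1 (x * y).
    by rewrite !mext_triv !mulf_eq0 invr_eq0 (negPf t10) orbF.
  rewrite -/c !mulr_sumr; apply: eq_bigr => u _.
  have -> : 1 - u * x - t = (1 - t) * (1 - u * (x / (1 - t))) by field.
  by rewrite mextM ?rpredV //; ring.
(* The correction requires 1 - u x = 0. *)
rewrite (bigD1 x^-1) //= big1 => [|u ux].
  rewrite mulVf // subrr eqxx mul1r addr0 appell_slice_inv //.
  by ring.
rewrite [_ == 0](_ : _ = false) ?mul0r ?mulr0 // subr_eq0 eq_sym.
by rewrite -[1](mulVf hx0) (inj_eq (mulIf hx0)) (negPf ux).
Qed.
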